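(* Let $(X,d)$ be a metric space, and let $\mathbf{b}$ be the relation of coarse closeness on the power set of $X$ (defined in the context). Let $A$, $B$ and $C$ be subsets of $X$. Then the following are true: (i) $A\,\mathbf{b}\,B$ implies $B\,\mathbf{b}\,A$; (ii) $(A\cup B)\,\mathbf{b}\,C$ if and only if $A\,\mathbf{b}\,C$ or $B\,\mathbf{b}\,C$; (iii) $A\,\mathbf{b}\,B$ implies that $A$ is unbounded and $B$ is unbounded; (iv) $A\,\bar{\mathbf{b}}\,B$ implies that there exists a set $E\subseteq X$ such that $A\,\bar{\mathbf{b}}\,E$ and $(X\setminus E)\,\bar{\mathbf{b}}\,B$; (v) if $A\cap B$ is not bounded, then $A\,\mathbf{b}\,B$.
   Context: For subsets $A,B$ of a metric space $(X,d)$ put $d(A,B)=\inf\{d(x,y)\mid x\in A, y\in B\}$, with $\inf\emptyset=\infty$. The sets $A$ and $B$ are coarsely close, written $A\,\mathbf{b}\,B$, if there exists $\epsilon<\infty$ such that for all bounded sets $D\subseteq X$, $d(A\setminus D,B\setminus D)<\epsilon$. The notation $A\,\bar{\mathbf{b}}\,B$ means that $A\,\mathbf{b}\,B$ does not hold. *)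

(* Defs.v *)
From mathcomp Require Import all_boot all_order all_algebra.
From mathcomp Require Import all_classical all_reals all_analysis.

Set Implicit Arguments.
Unset Strict Implicit.
Unset Printing Implicit Defensive.

Import Order.TTheory GRing.Theory Num.Theory.

Local Open Scope classical_set_scope.
Local Open Scope ring_scope.

(* Extended-real valued because the infimum of the empty set has to be +oo. *)
Definition set_dist (R : realType) (X : metricType R) (A B : set X) : \bar R :=
  ereal_inf [set (mdist x y)%:E | x in A & y in B].

(* Finite diameter, rather than inclusion in a ball: the empty set must be
   bounded even when X itself is empty. *)
Definition metric_bounded (R : realType) (X : metricType R) (D : set X) : Prop :=
  exists r : R, forall x y : X, D x -> D y -> mdist x y <= r.

Definition coarsely_close (R : realType) (X : metricType R) (A B : set X)
  : Prop :=
  exists eps : R, forall D : set X, metric_bounded D ->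
    (set_dist (A `\` D) (B `\` D) < eps%:E)%E.

(* Main.v *)
Require Import Defs.
From mathcomp Require Import all_boot all_order all_algebra.
From mathcomp Require Import all_classical all_reals all_analysis.
From mathcomp Require Import lra.

(** Sets fail to be coarsely close when, for every [e], the points of one that
    lie within [e] of the other form a bounded set: thickening the exceptional
    bounded set makes it enough to control one of the two endpoints. For the
    separation property (iv) take for [E] the points at least as close to [B]
    as to [A]. A point of [E] near [a] in [A] then has a point of [B] near it,
    and a point outside [E] near [b] in [B] has a point of [A] near it; either
    way the bound for [A] and [B] at twice the distance applies. *)

Set Implicit Arguments.
Unset Strict Implicit.
Unset Printing Implicit Defensive.

Import Order.TTheory GRing.Theory Num.Theory.

Local Open Scope classical_set_scope.
Local Open Scope ring_scope.

Section CoarseCloseness.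
Context {R : realType} {X : metricType R}.
Implicit Types A B C D : set X.

Lemma metric_bounded_subset A D :
  A `<=` D -> metric_bounded D -> metric_bounded A.
Proof. by move=> AD [r Dr]; exists r => x y /AD Dx /AD; exact: Dr. Qed.

Lemma metric_bounded_union A B :
  metric_bounded A -> metric_bounded B -> metric_bounded (A `|` B).
Proof.
move=> [r Ar] [s Bs].
have [->|/set0P[p Ap]] := eqVneq A set0; first by rewrite set0U; exists s.
have [->|/set0P[q Bq]] := eqVneq B set0; first by rewrite setU0; exists r.
(* Once both sets have a point, [r] and [s] are nonnegative, so the bound for mixed pairs, routed
   through [p] and [q], also covers pairs inside one set. *)
have r0 : 0 <= r by rewrite (le_trans _ (Ar _ _ Ap Ap)) ?mdist_ge0.
have s0 : 0 <= s by rewrite (le_trans _ (Bs _ _ Bq Bq)) ?mdist_ge0.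
have pq0 := mdist_ge0 p q.
have AB a b : A a -> B b -> mdist a b <= r + mdist p q + s.
  move=> Aa Bb; have := metric_triangle a p b; have := metric_triangle p q b.
  have := Ar _ _ Aa Ap; have := Bs _ _ Bq Bb; lra.
exists (r + mdist p q + s) => x y [Ax|Bx] [Ay|By].
- have := Ar _ _ Ax Ay; lra.
- exact: AB.
- by rewrite metric_sym; exact: AB.
- have := Bs _ _ Bx By; lra.
Qed.

Lemma metric_bounded_thickening D (e : R) : metric_bounded D ->
  metric_bounded [set x | exists2 y, D y & mdist x y < e].
Proof.
move=> [r Dr]; exists (e + r + e) => x x' [y Dy xy] [y' Dy' xy'].
have := metric_triangle x y x'; have := metric_triangle y y' x'.
have := Dr _ _ Dy Dy'; rewrite (metric_sym y' x').
lra.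
Qed.

Lemma set_dist_ltP A B (e : R) :
  (set_dist A B < e%:E)%E <-> exists a b, [/\ A a, B b & mdist a b < e].
Proof.
split=> [/ereal_inf_lt[_ [a Aa [b Bb <-]]]|[a [b [Aa Bb ab]]]].
  by rewrite lte_fin => ab; exists a, b.
apply: (@le_lt_trans _ _ (mdist a b)%:E); last by rewrite lte_fin.
by apply: ereal_inf_lbound; exists a => //; exists b.
Qed.

Lemma not_coarsely_closeP A B : ~ coarsely_close A B <->
  forall e : R, exists2 D, metric_bounded D &
    forall a b, A a -> B b -> mdist a b < e -> D a.
Proof.
split=> [nAB e|nAB [e AB]].
  have [D bD nD] : exists2 D, metric_bounded D &
      ~ (set_dist (A `\` D) (B `\` D) < e%:E)%E.
    apply: contrapT => nD; apply: nAB; exists e => D bD.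
    by apply: contrapT => ?; apply: nD; exists D.
  (* If [a] is outside this thickening, neither [a] nor [b] lies in [D], so the pair survives the
     removal of [D]. For [a] itself this uses [0 < e], forced by [mdist a b < e]. *)
  exists [set x | exists2 y, D y & mdist x y < e].
    exact: metric_bounded_thickening.
  move=> a b Aa Bb ab; apply: contrapT => na; apply/nD/set_dist_ltP.
  exists a, b; split=> //; (split=> // [?]); apply: na; last by exists b.
  by exists a => //; rewrite mdistxx (le_lt_trans _ ab) ?mdist_ge0.
have [D bD nD] := nAB e.
have /set_dist_ltP[a [b [[Aa nDa] [Bb _] ab]]] := AB _ bD.
exact: nDa (nD _ _ Aa Bb ab).
Qed.

Lemma coarsely_close_sym A B : coarsely_close A B -> coarsely_close B A.
Proof.
move=> [e AB]; exists e => D /AB /set_dist_ltP[a [b [Aa Bb ab]]].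
by apply/set_dist_ltP; exists b, a; rewrite metric_sym.
Qed.

Lemma coarsely_close_subset A A' B :
  A `<=` A' -> coarsely_close A B -> coarsely_close A' B.
Proof.
move=> AA' [e AB]; exists e => D /AB /set_dist_ltP[a [b [[Aa Da] Bb ab]]].
by apply/set_dist_ltP; exists a, b; split=> //; split=> //; exact: AA'.
Qed.

(** The criterion constrains only the endpoint in the union, so the exceptional sets of [A] and [B]
    for the same [e] can be joined. *)
Lemma coarsely_close_union A B C :
  coarsely_close (A `|` B) C <-> coarsely_close A C \/ coarsely_close B C.
Proof.
split=> [|[]]; last 2 first.
- by apply: coarsely_close_subset => x; left.
- by apply: coarsely_close_subset => x; right.
apply: contraPP => /not_orP[/not_coarsely_closeP nA /not_coarsely_closeP nB].
apply/not_coarsely_closeP => e.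
have [D bD nD] := nA e; have [D' bD' nD'] := nB e.
exists (D `|` D'); first exact: metric_bounded_union.
by move=> a c [Aa|Ba] Cc ac; [left; exact: nD ac|right; exact: nD' ac].
Qed.

Lemma coarsely_close_unbounded A B : coarsely_close A B -> ~ metric_bounded A.
Proof.
move=> AB bA; move: AB; apply/not_coarsely_closeP => e.
(* [A] is its own exceptional set, whatever [e] is. *)
by exists A.
Qed.

Lemma coarsely_close_separation A B : ~ coarsely_close A B ->
  exists E : set X, ~ coarsely_close A E /\ ~ coarsely_close (~` E) B.
Proof.
move=> nAB; have nBA : ~ coarsely_close B A by move/coarsely_close_sym.
(* Comparing points instead of infima makes both sides usable: membership gives a point of [B] no
   farther than a given [a], and non-membership gives one [a] strictly closer than all of [B]. *)
exists [set z | forall a, A a -> exists2 b, B b & mdist z b <= mdist z a].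
split; [|move/coarsely_close_sym]; apply/not_coarsely_closeP => e.
  have [D bD nD] := (not_coarsely_closeP _ _).1 nAB (e + e).
  (* The path from [a] through [z] to [b] has length at most twice [mdist a z], hence below
     [e + e]. *)
  exists D => // a z Aa /(_ a Aa)[b Bb zba] az; apply: (nD a b) => //.
  have := metric_triangle a z b; rewrite (metric_sym z a) in zba; lra.
have [D bD nD] := (not_coarsely_closeP _ _).1 nBA (e + e).
exists D => // b z Bb /existsNP[a /not_implyP[Aa nz]] bz.
apply: (nD b a) => //.
have zab : mdist z a < mdist z b.
  by rewrite ltNge; apply/negP => zba; apply: nz; exists b.
have := metric_triangle b z a; rewrite (metric_sym z b) in zab; lra.
Qed.

(** A common point is at distance 0 from itself, so any positive scale, here 1, puts the whole
    intersection in the exceptional set. *)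
Lemma unbounded_setI_coarsely_close A B :
  ~ metric_bounded (A `&` B) -> coarsely_close A B.
Proof.
apply: contra_notP => /not_coarsely_closeP/(_ 1)[D bD nD].
apply: metric_bounded_subset bD => x [Ax Bx].
by apply: (nD x x) => //; rewrite mdistxx.
Qed.

End CoarseCloseness.

Theorem theorem3p6 (R : realType) (X : metricType R) (A B C : set X) :
  (coarsely_close A B -> coarsely_close B A) /\
  (coarsely_close (A `|` B) C <-> coarsely_close A C \/ coarsely_close B C) /\
  (coarsely_close A B -> ~ metric_bounded A /\ ~ metric_bounded B) /\
  (~ coarsely_close A B ->
     exists E : set X, ~ coarsely_close A E /\ ~ coarsely_close (~` E) B) /\
  (~ metric_bounded (A `&` B) -> coarsely_close A B).
Proof.
split; first exact: coarsely_close_sym.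
split; first exact: coarsely_close_union.
split.
  move=> AB; split; first exact: coarsely_close_unbounded AB.
  exact: coarsely_close_unbounded (coarsely_close_sym AB).
split; first exact: coarsely_close_separation.
exact: unbounded_setI_coarsely_close.
Qed.
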